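(* For every integer $t\ge 3$, the number of distinct faultfree tromino tilings of the rectangle $R(4,3t)$ is $8\cdot 6^{t-3}$. Moreover, starting with the faultfree tilings of $R(4,9)$ and $R(4,12)$, and using the four generators (b), (c), (d), (e) described in the context (each extending a tiling by six columns), it is possible to generate all the distinct faultfree tilings of $R(4,3t)$, for all $t\ge 3$, exactly once.
   Context: $R(m,n)$ denotes the rectangle with $m$ rows and $n$ columns of unit squares; $(i,j)$ is the unit square in row $i$ (from the top) and column $j$ (from the left). A tromino is an L-shaped tromino, i.e. a $2\times 2$ block of unit squares with one removed, in any of its four orientations. A tromino tiling is a partition of the unit squares into trominoes. A fault line of a tiling is a horizontal or vertical line that cuts the rectangle into two (nonempty) pieces and does not pass through any tile; a tiling is faultfree if it has no fault line. Tilings are distinct whenever they differ as partitions (no identification under symmetries). A flip is reflection in the horizontal axis (rows $1,2,3,4$ become $4,3,2,1$). A ''block'' is a $2\times 3$ or $3\times 2$ rectangle tiled by two trominoes; each block can be tiled in two ways, and both are allowed. Initial pattern $P$: it occupies rows 1–2 of columns 1–5 and rows 3–4 of columns 1–4, and consists of the trominoes $\{(1,1),(1,2),(2,1)\}$, $\{(3,1),(4,1),(4,2)\}$, $\{(2,2),(3,2),(3,3)\}$, $\{(3,4),(4,3),(4,4)\}$ and a block on rows 1–2, columns 3–5. For $t\ge 3$, every faultfree tiling of $R(4,3t)$ begins at its left end with $P$ or with its flip. Using a generator: given a faultfree tiling of $R(4,3t)$ beginning with $P$, remove $P$, move the remaining part of the tiling six columns to the right, and fill the vacated region (rows 1–2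 of columns 1–11 and rows 3–4 of columns 1–10) in one of the following ways, giving a tiling of $R(4,3t+6)$. If the tiling begins with the flip of $P$, use the flipped generators. Tilings that agree outside the removed pattern (differing only in how its block is tiled) have the same remaining part, and each remaining part is used once with each filling. (b) $P$, together with blocks on rows 3–4, columns 5–7; rows 3–4, columns 8–10; rows 1–2, columns 6–8; rows 1–2, columns 9–11 (32 fillings). (c) The flip of $P$, together with trominoes $\{(1,5),(2,5),(1,6)\}$ and $\{(1,7),(1,8),(2,8)\}$, and blocks on rows 2–4, columns 6–7; rows 1–2, columns 9–11; rows 3–4, columns 8–10 (16 fillings). (d) $P$, together with trominoes $\{(3,5),(4,5),(4,6)\}$, $\{(4,7),(4,8),(3,8)\}$, $\{(1,8),(2,8),(1,9)\}$, $\{(1,10),(1,11),(2,11)\}$, and blocks on rows 1–3, columns 6–7; rows 2–4, columns 9–10 (8 fillings). (e) The flip of $P$, together with blocks on rows 1–2, columns 5–7; rows 3–4, columns 6–8; rows 2–4, columns 9–10, and trominoes $\{(1,8),(2,8),(1,9)\}$, $\{(1,10),(1,11),(2,11)\}$ (16 fillings). *)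

(* Defs.v *)
From mathcomp Require Import all_boot.
From mathcomp Require Import finmap.

Set Implicit Arguments.
Unset Strict Implicit.
Unset Printing Implicit Defensive.

Local Open Scope fset_scope.
Local Open Scope nat_scope.

(* (i, j) is the unit square in row i (from the top) and column j (from the
   left); rows and columns are numbered from 1. *)
Notation cell := (nat * nat)%type (only parsing).
Notation tile := {fset cell} (only parsing).
Notation tiles := {fset tile} (only parsing).

Definition rect (m n : nat) : {fset cell} :=
  [fset i in iota 1 m] `*` [fset j in iota 1 n].

(* The 2 x 2 block of unit squares whose top left square is c. *)
Definition square (c : cell) : {fset cell} :=
  [fset c; (c.1, c.2.+1); (c.1.+1, c.2); (c.1.+1, c.2.+1)].

(* The trominoes contained in rect m n; the top left squares of the 2 x 2
   blocks contained in rect m n are the cells of rect m.-1 n.-1. *)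
Definition trominoes (m n : nat) : {fset tile} :=
  [fset square c `\ d | c in rect m.-1 n.-1, d in square c].

Definition tilings (m n : nat) : {fset tiles} :=
  [fset T in fpowerset (trominoes m n)
    | trivIfset T && (fcover T == rect m n)].

(* The line between rows i and i.+1 does not pass through any tile of T. *)
Definition horizontal_fault (T : tiles) (i : nat) : bool :=
  all (fun B : tile => all (fun c : cell => c.1 <= i) B
                    || all (fun c : cell => i < c.1) B) T.

(* The line between columns j and j.+1 does not pass through any tile of T. *)
Definition vertical_fault (T : tiles) (j : nat) : bool :=
  all (fun B : tile => all (fun c : cell => c.2 <= j) B
                    || all (fun c : cell => j < c.2) B) T.

Definition faultfree (m n : nat) (T : tiles) : bool :=
  ~~ has (horizontal_fault T) (iota 1 m.-1) &&
  ~~ has (vertical_fault T) (iota 1 n.-1).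

Definition faultfree_tilings (m n : nat) : {fset tiles} :=
  [fset T in tilings m n | faultfree m n T].

(* Reflection in the horizontal axis of a rectangle with 4 rows. *)
Definition flip_cell (c : cell) : cell := (5 - c.1, c.2).
Definition flip_tile (B : tile) : tile := [fset flip_cell c | c in B].
Definition flip (T : tiles) : tiles := [fset flip_tile B | B in T].

Definition shift_cell (k : nat) (c : cell) : cell := (c.1, (c.2 + k)%N).
Definition shift_tile (k : nat) (B : tile) : tile :=
  [fset shift_cell k c | c in B].
Definition shift (k : nat) (T : tiles) : tiles :=
  [fset shift_tile k B | B in T].

Definition tromino (a b c : cell) : tile := [fset a; b; c].

(* The two tilings of the block on rows i, i+1 and columns j, j+1, j+2. *)
Definition hblock (i j : nat) : seq tiles :=
  [:: [fset tromino (i, j) (i.+1, j) (i, j.+1);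
            tromino (i.+1, j.+1) (i, j.+2) (i.+1, j.+2)];
      [fset tromino (i, j) (i.+1, j) (i.+1, j.+1);
            tromino (i, j.+1) (i, j.+2) (i.+1, j.+2)]].

(* The two tilings of the block on rows i, i+1, i+2 and columns j, j+1. *)
Definition vblock (i j : nat) : seq tiles :=
  [:: [fset tromino (i, j) (i, j.+1) (i.+1, j);
            tromino (i.+1, j.+1) (i.+2, j) (i.+2, j.+1)];
      [fset tromino (i, j) (i, j.+1) (i.+1, j.+1);
            tromino (i.+1, j) (i.+2, j) (i.+2, j.+1)]].

(* A pattern made of several parts, each given by the list of its possible
   tilings, is filled by choosing independently a tiling of each part. *)
Definition combine (parts : seq (seq tiles)) : seq tiles :=
  foldr (fun part acc => [seq p `|` q | p <- part, q <- acc])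
        [:: fset0] parts.

Definition pattern_P : seq tiles :=
  combine [::
    [:: [fset tromino (1, 1) (1, 2) (2, 1); tromino (3, 1) (4, 1) (4, 2);
              tromino (2, 2) (3, 2) (3, 3); tromino (3, 4) (4, 3) (4, 4)]];
    hblock 1 3].

Definition generator_b : seq tiles :=
  combine [:: pattern_P; hblock 3 5; hblock 3 8; hblock 1 6; hblock 1 9].

Definition generator_c : seq tiles :=
  combine [:: map flip pattern_P;
    [:: [fset tromino (1, 5) (2, 5) (1, 6); tromino (1, 7) (1, 8) (2, 8)]];
    vblock 2 6; hblock 1 9; hblock 3 8].

Definition generator_d : seq tiles :=
  combine [:: pattern_P;
    [:: [fset tromino (3, 5) (4, 5) (4, 6); tromino (4, 7) (4, 8) (3, 8);
              tromino (1, 8) (2, 8) (1, 9); tromino (1, 10) (1, 11) (2, 11)]];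
    vblock 1 6; vblock 2 9].

Definition generator_e : seq tiles :=
  combine [:: map flip pattern_P;
    hblock 1 5; hblock 3 6; vblock 2 9;
    [:: [fset tromino (1, 8) (2, 8) (1, 9); tromino (1, 10) (1, 11) (2, 11)]]].

Definition generators : seq tiles :=
  generator_b ++ generator_c ++ generator_d ++ generator_e.

(* In what follows the orientation o is false for P and the generators
   themselves, and true for their flips. *)
Definition oriented (o : bool) (s : seq tiles) : seq tiles :=
  if o then map flip s else s.

(* What remains of a tiling T after removing an initial P, together with the
   orientation of the removed pattern; empty if T begins neither with P nor
   with its flip. *)
Definition remaining_parts (T : tiles) : seq (bool * tiles) :=
  [seq (o, T `\` p) | o <- [:: false; true],
                      p <- [seq p <- oriented o pattern_P | p `<=` T]].

(* One use of the generators on a list of tilings: every remaining part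
   occurring in the list is used once (whence undup) with each filling.
   Tilings produced in several ways are repeated in the result. *)
Definition extend (s : seq tiles) : seq tiles :=
  [seq F `|` shift 6 r.2 | r <- undup (flatten (map remaining_parts s)),
                           F <- oriented r.1 generators].

(* The tilings of R(4, 3t), listed with multiplicity, obtained from the
   faultfree tilings of R(4, 9) and R(4, 12) by repeated use of the
   generators; meaningful only for t >= 3. *)
Fixpoint generated (t : nat) : seq tiles :=
  match t with
  | 3 => faultfree_tilings 4 9
  | 4 => faultfree_tilings 4 12
  | t'.+2 => extend (generated t')
  | _ => [::]
  end.

(* Main.v *)
Require Import Defs.
From mathcomp Require Import all_boot.
From mathcomp Require Import finmap.
From mathcomp Require Import zify.

Local Open Scope fset_scope.
Local Open Scope nat_scope.

(** A tromino meets exactly two consecutive columns and two consecutive rows.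
    So a column line is a fault exactly when no tile has its left cells just
    before it, a row line is a fault exactly when no tile has its upper cells
    just above it, and a tiling of R(4, n) is the same thing as a word of n - 1
    letters: the letter of column j lists the tiles whose left column is j.
    The tiles filling column j are those of letters j - 1 and j, so only the
    rows that a letter occupies in its right column matter for the letters
    that follow: faultfree tilings are the accepted words of a finite
    automaton whose states are sets of rows (mem_words, perm_faultfree), the
    empty letter, that is a vertical fault, being excluded.

    This automaton is small where it matters.  After 4 columns the occupied
    rows of the next column are 1-2, 3-4 or 2-3, and the same holds three
    columns later if one starts from 1-2 or 3-4.  The state 2-3 is excluded
    when at least two letters remain (words_dead), so a long enough word can be
    cut after column 4, 7, 10, ... into two words meeting at the state 1-2 or
    3-4 (words_split).

    Each of these two states is reached by two words of length 4, which are
    the tilings of P and of its flip (perm_pattern_P); all of them already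
    cross the three horizontal lines, which rules out horizontal faults.
    Three more columns lead from a state to itself in 4 ways and to the other
    one in 2 ways, whence the factor 6 (size_words); two completions of each
    state remain for R(4, 9), and 4 * 2 = 8.

    The generators fit the same cut, made at column 10: the 72 fillings are
    exactly the 72 words of length 10 that lead from the empty state to 1-2,
    and their flips are those that lead to 3-4 (perm_generators).  The
    remaining parts of the tilings of R(4, 3t) are the words that complete
    1-2 or 3-4, taken once each (mem_remaining_parts), so using the generators
    on them lists the words of R(4, 3t + 6) cut at column 10, once each
    (extend_words). *)

(** * Trominoes as codes *)

(** The piece (i, (dr, dc)) is a tromino up to horizontal translation: its
    2 x 2 square occupies rows i and i + 1, and the cell missing from it is
    dr rows below and dc columns to the right of the top left one. *)
Definition piece := (nat * (bool * bool))%type.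

(** The left column of the tromino, and its piece. *)
Definition code := (nat * piece)%type.

Definition left_rows (p : piece) : seq nat :=
  let: (i, (dr, dc)) := p in if dc then [:: i; i.+1] else [:: if dr then i else i.+1].

Definition right_rows (p : piece) : seq nat :=
  let: (i, (dr, dc)) := p in left_rows (i, (dr, ~~ dc)).

Definition column (j : nat) (rows : seq nat) : seq (nat * nat) := [seq (i, j) | i <- rows].

Lemma mem_column j rows x : (x \in column j rows) = (x.2 == j) && (x.1 \in rows).
Proof.
case: x => i k /=; apply/mapP/andP => [[i' i'P [-> ->]]|[/eqP -> iP]]; last by exists i.
by rewrite eqxx.
Qed.

Definition cells (c : code) : seq (nat * nat) :=
  column c.1 (left_rows c.2) ++ column c.1.+1 (right_rows c.2).

Definition tile_of (c : code) : {fset nat * nat} := [fset x in cells c].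

Lemma mem_cells (c : code) (x : nat * nat) :
  (x \in cells c) = (x.2 == c.1) && (x.1 \in left_rows c.2)
                 || (x.2 == c.1.+1) && (x.1 \in right_rows c.2).
Proof. by rewrite mem_cat !mem_column. Qed.

Lemma mem_tile_of (c : code) (x : nat * nat) : (x \in tile_of c) = (x \in cells c).
Proof. by rewrite in_fset. Qed.

Lemma all_tile_of (c : code) (P : pred (nat * nat)) : all P (tile_of c) = all P (cells c).
Proof. by apply: eq_all_r => x; exact: mem_tile_of. Qed.

Lemma rows_sorted (p : piece) : sorted ltn (left_rows p) * sorted ltn (right_rows p).
Proof. by case: p => i [[] []]; split=> //=; rewrite ltnSn. Qed.

Lemma rows_inj (p q : piece) :
  left_rows p = left_rows q -> right_rows p = right_rows q -> p = q.
Proof.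
case: p q => i [[] []] [j [[] []]] //= eq_l eq_r; case: eq_l; case: eq_r; intros;
  (exfalso; lia) || (congr (_, _); lia).
Qed.

(** The left column of a tile is its smallest one, so equal tiles have equal
    left columns; the rows occupied in both columns then give the piece. *)
Lemma tile_of_inj : injective tile_of.
Proof.
have leq_col c d : tile_of c = tile_of d -> d.1 <= c.1.
  move=> /fsetP eq_cd.
  have [i iP] : exists i, i \in left_rows c.2.
    by case: (c.2) => i [dr []]; [exists i | exists (if dr then i else i.+1)];
      rewrite inE eqxx.
  move: (eq_cd (i, c.1)); rewrite !mem_tile_of !mem_cells /= eqxx iP /=.
  by case: ltngtP => // ltcd; rewrite ltn_eqF ?leqW.
move=> c d eq_cd; have eq_col : c.1 = d.1.
  by apply/eqP; rewrite eqn_leq !leq_col.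
move/fsetP: eq_cd => eq_cd; case: c d eq_col eq_cd => j p [_ q] /= <- eq_cd.
have eq_rows i : ((i \in left_rows p) = (i \in left_rows q)) *
                 ((i \in right_rows p) = (i \in right_rows q)).
  split; [move: (eq_cd (i, j)) | move: (eq_cd (i, j.+1))];
    rewrite !mem_tile_of !mem_cells /= eqxx.
    by rewrite ltn_eqF // !orbF.
  by rewrite gtn_eqF.
congr (_, _); apply: rows_inj; apply: (irr_sorted_eq ltn_trans ltnn) => [||i];
  by rewrite ?rows_sorted ?eq_rows.
Qed.

Definition pieces : seq piece :=
  [seq (i, (dr, dc)) | i <- iota 1 3,
     '(dr, dc) <- [:: (false, false); (false, true); (true, false); (true, true)]].

Arguments pieces : simpl never.

Lemma mem_pieces (p : piece) : (p \in pieces) = (p.1 \in iota 1 3).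
Proof.
by case: p => [[|[|[|[|i]]]] [[] []]].
Qed.

Lemma square_missing i j dr dc :
  square (i, j) `\ ((if dr then i.+1 else i), (if dc then j.+1 else j))
  = tile_of (j, (i, (dr, dc))).
Proof.
apply/fsetP => -[a b]; rewrite mem_tile_of mem_cells /square !inE /= !xpair_eqE.
by case: dr dc => [] [] /=; rewrite !inE; lia.
Qed.

Lemma trominoesP n (B : {fset nat * nat}) :
  reflect (exists2 c : code, (c.1 \in iota 1 n.-1) && (c.2 \in pieces) & B = tile_of c)
          (B \in trominoes 4 n).
Proof.
apply: (iffP (imfset2P _ _ _ _ _)) => [[[i j]] | [[j [i [dr dc]]]]] /=.
  rewrite inE /= !inE /= => /andP[iP jP] [d dP ->].
  have [dr [dc ->]] : exists dr dc,
      d = ((if dr then i.+1 else i), (if dc then j.+1 else j)).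
    move: dP; rewrite !inE -!orbA => /or4P[] /eqP ->;
      [exists false, false | exists false, true | exists true, false
      | exists true, true]; by [].
  exists (j, (i, (dr, dc))); last by rewrite square_missing.
  by rewrite jP mem_pieces; exact: iP.
rewrite mem_pieces /= => /andP[jP iP] ->; exists (i, j) => /=.
  by rewrite inE /= !in_fset jP andbT; exact: iP.
exists ((if dr then i.+1 else i), (if dc then j.+1 else j)).
  by rewrite /square !inE /= !xpair_eqE; case: dr dc => [] []; rewrite !eqxx ?orbT.
by rewrite square_missing.
Qed.

Definition tiles_of (cs : seq code) : {fset {fset nat * nat}} := [fset tile_of c | c in cs].

Lemma mem_tiles_of (cs : seq code) (c : code) : (tile_of c \in tiles_of cs) = (c \in cs).
Proof. by rewrite mem_imfset //; exact: tile_of_inj. Qed.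

Lemma tiles_ofP (cs : seq code) (B : {fset nat * nat}) :
  reflect (exists2 c, c \in cs & B = tile_of c) (B \in tiles_of cs).
Proof. exact: (iffP (imfsetP _ _ _ _)). Qed.

Lemma all_tiles_of (P : pred {fset nat * nat}) (cs : seq code) :
  all P (tiles_of cs) = all (P \o tile_of) cs.
Proof.
apply/allP/allP => [allP c cP | allP B /tiles_ofP[c cP ->]]; last exact: allP.
by apply: allP; rewrite mem_tiles_of.
Qed.

Lemma tiles_of_sub (cs ds : seq code) :
  (tiles_of cs `<=` tiles_of ds) = all (mem ds) cs.
Proof.
apply/fsubsetP/allP => [sub c cP | sub B /tiles_ofP[c cP ->]].
  by have := sub (tile_of c); rewrite !mem_tiles_of; exact.
by rewrite mem_tiles_of; exact: sub.
Qed.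

Lemma tiles_of_cat (cs ds : seq code) :
  tiles_of (cs ++ ds) = tiles_of cs `|` tiles_of ds.
Proof.
apply/fsetP => B; rewrite inE; apply/tiles_ofP/orP => [[c]|].
  by rewrite mem_cat => /orP[] cP ->; [left | right]; rewrite mem_tiles_of.
by move=> [] /tiles_ofP[c cP ->]; exists c; rewrite // mem_cat cP ?orbT.
Qed.

Lemma eq_tiles_of (cs ds : seq code) : cs =i ds -> tiles_of cs = tiles_of ds.
Proof.
move=> eq; apply/fsetP => B; apply/tiles_ofP/tiles_ofP => -[c cP ->];
  by exists c; rewrite ?eq // -eq.
Qed.

Lemma tiles_of_inj (cs ds : seq code) : tiles_of cs = tiles_of ds -> cs =i ds.
Proof. by move=> eq c; rewrite -!mem_tiles_of eq. Qed.

(** * Tilings as exact covers *)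

Definition columns (j n : nat) : seq (nat * nat) :=
  flatten [seq column k (iota 1 4) | k <- iota j n].

Lemma columnsS j n : columns j n.+1 = column j (iota 1 4) ++ columns j.+1 n.
Proof. by []. Qed.

Lemma mem_columns j n x : (x \in columns j n) = (x.1 \in iota 1 4) && (x.2 \in iota j n).
Proof.
apply/flatten_mapP/andP => [[k kP]|[iP jP]].
  by rewrite mem_column => /andP[/eqP -> ->].
by exists x.2; rewrite // mem_column eqxx.
Qed.

Lemma uniq_columns j n : uniq (columns j n).
Proof.
elim: n j => // n IHn j; rewrite columnsS cat_uniq IHn andbT.
rewrite map_inj_uniq ?iota_uniq; last by move=> ? ? [].
apply/hasPn => x; rewrite mem_columns !mem_iota mem_column => /andP[_ /andP[ltjx _]].
by rewrite gtn_eqF.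
Qed.

Lemma perm_cat_split (T : eqType) (P : pred T) (s1 s2 t1 t2 : seq T) :
    all P s1 -> all (predC P) s2 -> all P t1 -> all (predC P) t2 ->
  perm_eq (s1 ++ s2) (t1 ++ t2) = perm_eq s1 t1 && perm_eq s2 t2.
Proof.
move=> Ps1 Ps2 Pt1 Pt2; apply/idP/andP => [eq_st | [eq1 eq2]]; last exact: perm_cat.
have filter0 Q (s : seq T) : all (predC Q) s -> filter Q s = [::].
  by elim: s => //= x s IHs /andP[/negPf ->].
split.
  move/(perm_filter P): eq_st; rewrite !filter_cat (filter0 _ _ Ps2) (filter0 _ _ Pt2).
  by rewrite !cats0 (all_filterP Ps1) (all_filterP Pt1).
have filter1 (s : seq T) : all P s -> filter (predC P) s = [::].
  by move=> Ps; apply: filter0; apply: sub_all Ps => x /= ->.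
move/(perm_filter (predC P)): eq_st; rewrite !filter_cat (filter1 _ Ps1) (filter1 _ Pt1).
by rewrite /= (all_filterP Ps2) (all_filterP Pt2).
Qed.

Lemma uniq_cells c : uniq (cells c).
Proof.
have Urows := sorted_uniq ltn_trans ltnn.
rewrite cat_uniq !map_inj_uniq ?Urows ?rows_sorted //=; try by move=> ? ? [].
rewrite andbT; apply/hasPn => x; rewrite !mem_column => /andP[/eqP -> _].
by rewrite gtn_eqF.
Qed.

(** Disjointness of the tiles is defined by a sum of cardinals, so it amounts
    to the absence of repetitions in the list of all their cells. *)
Lemma tilings_tiles_of n cs :
    uniq cs -> tiles_of cs `<=` trominoes 4 n ->
  (tiles_of cs \in tilings 4 n) = perm_eq (flatten (map cells cs)) (columns 1 n).
Proof.
move=> Ucs sub_cs; rewrite /tilings !inE /= fpowersetE sub_cs /=.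
set flat := flatten _.
have cover_flat : fcover (tiles_of cs) = [fset x in flat].
  apply/fsetP => x; rewrite in_fset; apply/bigfcupP/flatten_mapP => [[B]|[c cP xP]].
    by rewrite andbT => /tiles_ofP[c cP ->]; rewrite mem_tile_of; exists c.
  by exists (tile_of c); rewrite ?mem_tiles_of ?cP ?mem_tile_of.
have -> : trivIfset (tiles_of cs) = uniq flat.
  rewrite /trivIfset cover_flat card_fseq.
  have -> : \sum_(B <- tiles_of cs) #|` B| = size flat.
    rewrite (perm_big (map tile_of cs)) /=; last first.
      apply: uniq_perm; rewrite ?fset_uniq ?map_inj_uniq //; first exact: tile_of_inj.
      by move=> B; apply/tiles_ofP/mapP.
    rewrite big_map size_flatten /shape -map_comp sumnE big_map; apply: eq_bigr => c _.
    by rewrite card_fseq undup_id ?uniq_cells.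
  by rewrite (uniq_size_uniq (undup_uniq flat)) // => x; rewrite mem_undup.
have mem_rect x : (x \in rect 4 n) = (x \in columns 1 n).
  by rewrite mem_columns inE !in_fset.
rewrite cover_flat; apply/andP/idP => [[Uflat /eqP/fsetP eq_flat] | eq_flat].
  by apply: uniq_perm; rewrite ?uniq_columns // => x; rewrite -mem_rect -eq_flat in_fset.
rewrite (perm_uniq eq_flat) uniq_columns; split=> //; apply/eqP/fsetP => x.
by rewrite in_fset (perm_mem eq_flat) mem_rect.
Qed.

(** * Tilings as words *)

(** The pieces of the tiles that have a given left column. *)
Definition letter := seq piece.
Definition word := seq letter.

Definition lefts (a : letter) : seq nat := flatten (map left_rows a).
Definition rights (a : letter) : seq nat := flatten (map right_rows a).

Fixpoint codes (j : nat) (w : word) : seq code :=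
  if w is a :: w' then [seq (j, p) | p <- a] ++ codes j.+1 w' else [::].

Lemma mem_codes j w c :
  (c \in codes j w) = (j <= c.1) && (c.2 \in nth [::] w (c.1 - j)).
Proof.
case: c => k p /=; elim: w j => [|a w IHw] j; first by rewrite nth_nil andbF.
rewrite /= mem_cat IHw; have -> : ((k, p) \in [seq (j, q) | q <- a]) = (k == j) && (p \in a).
  by apply/mapP/andP => [[q qP [-> ->]] | [/eqP -> pP]]; [rewrite eqxx | exists p].
by case: (ltngtP j k) => [ltjk | | ->]; rewrite ?orbF ?subnn // -[k - j]subnSK.
Qed.

Lemma codes_cat j u v : codes j (u ++ v) = codes j u ++ codes (j + size u) v.
Proof. by elim: u j => [|a u IHu] j /=; rewrite ?addn0 // IHu catA addSnnS. Qed.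

Definition full (m : seq nat) : bool := perm_eq m (iota 1 4).

(** Here m is the state of the automaton: the rows that earlier tiles already
    occupy in the column of the first letter of w. *)
Fixpoint exact (m : seq nat) (w : word) : bool :=
  if w is a :: w' then full (m ++ lefts a) && exact (rights a) w' else full m.

Lemma column_cat j s t : column j (s ++ t) = column j s ++ column j t.
Proof. exact: map_cat. Qed.

Lemma perm_column j s t : perm_eq (column j s) (column j t) = perm_eq s t.
Proof.
apply/idP/idP; last exact: perm_map.
by apply: perm_map_inj => ? ? [].
Qed.

Lemma perm_cells_letter j (a : letter) :
  perm_eq (flatten [seq cells (j, p) | p <- a]) (column j (lefts a) ++ column j.+1 (rights a)).
Proof.
elim: a => // p a IHa; rewrite /lefts /rights /= !column_cat.
rewrite /cells -!catA perm_cat2l.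
by rewrite perm_sym perm_catCA perm_sym perm_cat2l.
Qed.

(** By induction on the word: the cells of column j are those of m and the left
    cells of the first letter, everything else lies further to the right. *)
Lemma exactE j m w :
  perm_eq (column j m ++ flatten (map cells (codes j w))) (columns j (size w).+1) = exact m w.
Proof.
elim: w j m => [|a w IHw] j m; first by rewrite cats0 columnsS cats0 perm_column.
rewrite [codes _ _]/= map_cat flatten_cat -map_comp columnsS.
rewrite (permPl (perm_cat (perm_refl _) (perm_cat (perm_cells_letter _ _) (perm_refl _)))).
rewrite -catA catA -column_cat (@perm_cat_split _ (fun x => x.2 == j)).
- by rewrite perm_column IHw.
- by apply/allP => x; rewrite mem_column => /andP[].
- apply/allP => x; rewrite mem_cat mem_column => /orP[/andP[/eqP] | /flatten_mapP[c]] /=.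
    by move=> ->; rewrite gtn_eqF.
  rewrite mem_codes mem_cells => /andP[ltjc _].
  by case/orP => /andP[/eqP -> _]; rewrite gtn_eqF ?(leq_trans ltjc).
- by apply/allP => x; rewrite mem_column => /andP[].
apply/allP => x; rewrite mem_columns [_ \in iota j.+1 _]mem_iota => /and3P[_ ltjx _] /=.
by rewrite gtn_eqF.
Qed.

Definition decode (j : nat) (w : word) := tiles_of (codes j w).

(** Among the lists with given elements, the subsequence of pieces is unique:
    this makes the word of a tiling unique. *)
Definition is_letter (a : letter) : bool := subseq a pieces.
Arguments is_letter : simpl never.
Definition is_word : pred word := all is_letter.

Lemma uniq_pieces : uniq pieces.
Proof. by []. Qed.

Lemma eq_subseq (T : eqType) (s a b : seq T) :
  uniq s -> subseq a s -> subseq b s -> a =i b -> a = b.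
Proof.
move=> Us /(subseq_uniqP Us) def_a /(subseq_uniqP Us) def_b eq_ab.
by rewrite def_a def_b; apply: eq_filter => x; exact: eq_ab.
Qed.

Lemma decode_inj j u v :
  size u = size v -> is_word u -> is_word v -> decode j u = decode j v -> u = v.
Proof.
move=> eq_size /all_nthP Wu /all_nthP Wv /tiles_of_inj eq_codes.
apply: (@eq_from_nth _ [::]) => // i ltiu.
apply: (eq_subseq _ _ _ _ uniq_pieces) => [||p]; [exact: Wu | by apply: Wv; rewrite -eq_size |].
by have := eq_codes (j + i, p); rewrite !mem_codes /= leq_addr addKn.
Qed.

Definition word_of (n : nat) (P : pred code) : word :=
  [seq [seq p <- pieces | P (j, p)] | j <- iota 1 n].

Lemma is_word_of n P : is_word (word_of n P).
Proof. by apply/allP => _ /mapP[j _ ->]; exact: filter_subseq. Qed.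

Lemma mem_codes_word_of n P c :
  (c \in codes 1 (word_of n P)) = [&& c.1 \in iota 1 n, c.2 \in pieces & P c].
Proof.
rewrite mem_codes mem_iota; case: c => [[|j] p] //=; rewrite subSS subn0 !add1n ltnS.
have [ltjn | lenj] := ltnP; last by rewrite nth_default ?size_map ?size_iota.
by rewrite (nth_map 0) ?size_iota // mem_filter nth_iota // add1n andbC.
Qed.

Lemma uniq_codes j w : is_word w -> uniq (codes j w).
Proof.
elim: w j => //= a w IHw j /andP[Wa Ww]; rewrite cat_uniq IHw // andbT.
have Ua : uniq a := subseq_uniq Wa uniq_pieces.
rewrite map_inj_uniq; last by move=> ? ? [].
rewrite Ua /=.
apply/hasPn => c; rewrite mem_codes => /andP[ltjc _].
by apply/mapP => -[p _ def_c]; rewrite def_c /= ltnn in ltjc.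
Qed.

Lemma is_wordP w a p : is_word w -> a \in w -> p \in a -> p \in pieces.
Proof. by move=> /allP Ww aw; apply: mem_subseq; exact: Ww. Qed.

Lemma codes_sub w c :
  is_word w -> c \in codes 1 w -> (c.1 \in iota 1 (size w)) && (c.2 \in pieces).
Proof.
rewrite mem_codes => Ww /andP[c_gt0 cP].
have ltc : c.1 - 1 < size w by rewrite ltnNge; apply: contraL cP => ?; rewrite nth_default.
rewrite mem_iota c_gt0 (is_wordP _ _ _ Ww (mem_nth [::] ltc) cP).
by move: ltc c_gt0; lia.
Qed.

Lemma trominoes_decode n w :
  size w = n.-1 -> is_word w -> decode 1 w `<=` trominoes 4 n.
Proof.
move=> size_w Ww; apply/fsubsetP => _ /tiles_ofP[c cP ->].
by apply/trominoesP; exists c; rewrite // -size_w codes_sub.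
Qed.

Lemma tilings_decode n w :
  size w = n -> is_word w -> (decode 1 w \in tilings 4 n.+1) = exact [::] w.
Proof.
move=> size_w Ww; rewrite tilings_tiles_of ?uniq_codes //; last exact: trominoes_decode.
by rewrite -(exactE 1) size_w.
Qed.

(** A tile always occupies both of its columns, so it straddles exactly the
    line on the right of its left column. *)
Lemma vertical_fault_decode w j :
  0 < j -> vertical_fault (decode 1 w) j = (nth [::] w j.-1 == [::]).
Proof.
move=> j_gt0; rewrite /vertical_fault all_tiles_of.
have straddle c : all (fun x : nat * nat => x.2 <= j) (tile_of c)
          || all (fun x : nat * nat => j < x.2) (tile_of c) = (c.1 != j).
  rewrite !all_tile_of /cells; case: c => k [i [dr dc]] /=.
  by case: dc => /=; lia.
rewrite (eq_all straddle); apply/allP/eqP => [no_j | nth0 c].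
  case def_a: (nth _ _ _) => [|p a] //; have := no_j (j, p).
  by rewrite mem_codes /= j_gt0 subn1 def_a inE !eqxx => /(_ isT).
by rewrite mem_codes => /andP[_ cP]; apply: contraTneq cP => ->; rewrite subn1 nth0.
Qed.

(** A tile always occupies both of its rows, so it straddles exactly the line
    below its upper row. *)
Lemma horizontal_fault_decode w i :
  horizontal_fault (decode 1 w) i = ~~ has (has (fun p => p.1 == i)) w.
Proof.
rewrite /horizontal_fault all_tiles_of.
have straddle c : all (fun x : nat * nat => x.1 <= i) (tile_of c)
          || all (fun x : nat * nat => i < x.1) (tile_of c) = (c.2.1 != i).
  rewrite !all_tile_of /cells; case: c => k [i' [dr dc]] /=.
  by case: dr dc => [] [] /=; lia.
rewrite (eq_all straddle) all_predC; congr (~~ _).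
elim: w 1 => //= a w IHw j; rewrite has_cat IHw has_map.
by congr (_ || _); apply: eq_has.
Qed.

Lemma faultfree_decode n w :
  size w = n -> faultfree 4 n.+1 (decode 1 w) =
  all (fun i => has (has (fun p => p.1 == i)) w) (iota 1 3) && ([::] \notin w).
Proof.
move=> size_w; rewrite /faultfree -!all_predC; congr (_ && _).
  by apply: eq_all => i /=; rewrite horizontal_fault_decode negbK.
apply/allP/idP => [no_fault | no_nil j].
  apply/negP => /(nthP [::])[i ltiw nth_i]; have := no_fault i.+1.
  rewrite mem_iota /= vertical_fault_decode // nth_i eqxx add1n -size_w ltnS ltiw.
  by move=> /(_ isT).
rewrite mem_iota /= add1n => /andP[j_gt0 ltjn]; rewrite vertical_fault_decode //.
apply: contraNneq no_nil => <-; apply: mem_nth; rewrite size_w; lia.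
Qed.

Lemma decode_word_of n (T : {fset {fset nat * nat}}) :
  T `<=` trominoes 4 n -> T = decode 1 (word_of n.-1 [pred c | tile_of c \in T]).
Proof.
move=> /fsubsetP subT; apply/fsetP => B; apply/idP/tiles_ofP => [BT | [c cP ->]].
  have /trominoesP[c cP def_B] := subT B BT.
  by exists c; rewrite // mem_codes_word_of andbA cP /= -def_B.
by move: cP; rewrite mem_codes_word_of => /and3P[_ _].
Qed.

(** * Enumeration of the words *)

(** The subsequences of s whose left cells complete the rows m; partial choices
    that already overlap are pruned, which keeps the computations short. *)
Fixpoint completions (m : seq nat) (s : seq piece) : seq letter :=
  if s is p :: s' then
    (if uniq (m ++ left_rows p)
     then [seq p :: a | a <- completions (m ++ left_rows p) s'] else [::])
    ++ completions m s'
  else if full m then [:: [::]] else [::].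

Lemma mem_completions m s a : uniq s ->
  (a \in completions m s) = subseq a s && full (m ++ lefts a).
Proof.
elim: s m a => [|p s IHs] m a.
  move=> _; rewrite subseq0 /=; have [-> | nz_a] := eqVneq a [::].
    by rewrite cats0; case: ifP; rewrite ?inE.
  by case: ifP => _; rewrite ?inE // (negPf nz_a).
rewrite [uniq _]/= [completions _ _]/= => /andP[p_s Us]; rewrite mem_cat IHs //.
have skip : (a \in [seq p :: b | b <- completions (m ++ left_rows p) s]) =
            [&& a != [::], head p a == p, subseq (behead a) s & full (m ++ lefts a)].
  apply/mapP/and4P => [[b]|].
    by rewrite IHs // -catA => /andP[sub_b full_b] ->; rewrite eqxx.
  case: a => [|q a] [] //= _ /eqP -> sub_a full_a; exists a => //.
  by rewrite IHs // sub_a -catA.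
have -> : (a \in if uniq (m ++ left_rows p)
           then [seq p :: b | b <- completions (m ++ left_rows p) s] else [::]) =
          [&& a != [::], head p a == p, subseq (behead a) s & full (m ++ lefts a)].
  case: ifP => // not_uniq; apply/esym/and4P => -[].
  case: a {skip} => //= q a _ /eqP -> _ /perm_uniq; rewrite iota_uniq.
  by rewrite /lefts /= catA cat_uniq not_uniq.
case: a {skip} => [|q a] /=; first by rewrite sub0seq.
case: eqP => [-> | _] //=; case: (full _); rewrite ?andbF ?andbT //.
apply/orP/idP => [[// | sub_a] | ->]; last by left.
exact: subseq_trans (subseq_cons _ _) sub_a.
Qed.

Lemma uniq_completions m s : uniq s -> uniq (completions m s).
Proof.
elim: s m => [|p s IHs] m /=; first by case: ifP.
move=> /andP[p_s Us]; rewrite cat_uniq IHs // andbT; case: ifP => //= _.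
  rewrite map_inj_uniq ?(IHs _ Us) /=; last by move=> ? ? [].
  apply/hasPn => a; rewrite mem_completions // => /andP[sub_a _].
  by apply: contra p_s => /mapP[b _ def_a]; rewrite (mem_subseq sub_a) // def_a inE eqxx.
by apply/hasPn.
Qed.

Definition letters_after (m : seq nat) : seq letter :=
  [seq a <- completions m pieces | a != [::]].

(** The condition E on the final state is a parameter because the same
    enumeration serves for complete words, for all prefixes, and for the
    prefixes that lead to a given state. *)
Fixpoint paths (E : pred (seq nat)) (m : seq nat) (L : nat) : seq word :=
  if L is L'.+1 then [seq a :: w | a <- letters_after m, w <- paths E (rights a) L']
  else if E m then [:: [::]] else [::].

Definition words := paths full.

Definition final (m : seq nat) (w : word) : seq nat := last m [seq rights a | a <- w].

Lemma mem_letters_after m a :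
  (a \in letters_after m) = [&& a != [::], is_letter a & full (m ++ lefts a)].
Proof. by rewrite mem_filter mem_completions ?uniq_pieces. Qed.

Lemma mem_words m L w :
  (w \in words m L) = [&& size w == L, is_word w, [::] \notin w & exact m w].
Proof.
rewrite /words; elim: L m w => [|L IHL] m [|a w] /=.
- by rewrite -/(full m); case: (full m).
- by case: (full m).
- by apply/allpairsPdep => -[a [w []]].
rewrite -/(full _) eqSS inE [[::] == a]eq_sym.
apply/allpairsPdep/idP => [[b [v [b_m v_b [-> ->]]]]|].
  move: b_m v_b; rewrite mem_letters_after IHL => /and3P[nz_b -> ->] /and4P[-> -> nz_v ->].
  by rewrite negb_or nz_b nz_v.
case/and4P=> size_w /andP[Wa Ww]; rewrite negb_or => /andP[nz_a nz_w] /andP[full_a ex_w].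
by exists a, w; rewrite mem_letters_after IHL nz_a Wa full_a size_w Ww nz_w.
Qed.

Lemma decode_words_inj j m L : {in words m L &, injective (decode j)}.
Proof.
move=> u v; rewrite !mem_words => /and3P[/eqP size_u Wu _] /and3P[/eqP size_v Wv _].
by apply: decode_inj; rewrite // size_u.
Qed.

Lemma uniq_paths E m L : uniq (paths E m L).
Proof.
elim: L m => [|L IHL] m /=; first by case: ifP.
apply: allpairs_uniq_dep => [|a _|]; rewrite ?IHL ?filter_uniq ?uniq_completions //.
by move=> [a v] [b w] _ _ /= [-> ->].
Qed.

Lemma size_paths E m L w : w \in paths E m L -> size w = L.
Proof.
elim: L m w => [|L IHL] m w /=; first by case: ifP; rewrite // inE => _ /eqP ->.
by case/allpairsPdep=> a [v [_ /IHL <- ->]].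
Qed.

Lemma paths_add E m a b :
  paths E m (a + b) = [seq x ++ y | x <- paths predT m a, y <- paths E (final m x) b].
Proof.
elim: a m => [|a IHa] m; first by rewrite allpairs1l map_id.
rewrite addSn /=; elim: (letters_after m) => // c s IHs /=.
rewrite {}IHs allpairs_cat; congr (_ ++ _).
by rewrite IHa map_allpairs allpairs_mapl.
Qed.

Lemma paths_filter (E : pred (seq nat)) m L :
  paths E m L = [seq w <- paths predT m L | E (final m w)].
Proof.
elim: L m => [|L IHL] m //=; elim: (letters_after m) => //= a s IHs.
by rewrite filter_cat -IHs IHL filter_map.
Qed.

(** * The automaton between columns 4, 7, 10, ... *)

(** The two states reached after a tiling of P (o = false) or of its flip
    (o = true). *)
Definition half_rows (o : bool) : seq nat := if o then [:: 3; 4] else [:: 1; 2].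
Definition heads (m : seq nat) (L : nat) (o : bool) := paths (pred1 (half_rows o)) m L.

(** From this state rows 1 and 4 are filled by two distinct tiles, which occupy the whole next
    column: either the tiling ends there, or it has a vertical fault. *)
Lemma words_dead L : 2 <= L -> words [:: 2; 3] L = [::].
Proof.
move=> leL; rewrite -(subnKC leL) /words paths_add.
have -> : paths predT [:: 2; 3] 2 = [::] by vm_compute.
by [].
Qed.

(** The condition under which all words that start from m can be cut after L
    letters; it is checked by computation where it is used. *)
Definition splits m L : bool :=
  all (fun x => final m x \in [:: half_rows false; half_rows true; [:: 2; 3]])
      (paths predT m L).

(** The cut is made at the state reached after a letters; words that reach the
    state 2-3 there contribute nothing, by words_dead. *)
Lemma words_split m a b : splits m a -> 2 <= b ->
  perm_eq (words m (a + b))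
    ([seq x ++ y | x <- heads m a false, y <- words (half_rows false) b] ++
     [seq x ++ y | x <- heads m a true, y <- words (half_rows true) b]).
Proof.
move=> + leb; rewrite /words paths_add /heads ![paths (pred1 _) _ _]paths_filter /splits.
elim: (paths predT m a) => //= x s IHs /andP[x_m /IHs eq_s].
rewrite !inE in x_m; case/or3P: x_m => /eqP -> /=.
- by rewrite -catA perm_cat2l.
- by rewrite perm_sym perm_catCA perm_sym perm_cat2l.
by rewrite -/words words_dead.
Qed.

Lemma splits4 : splits [::] 4.
Proof. by vm_compute. Qed.

Lemma splits10 : splits [::] 10.
Proof. by vm_compute. Qed.

Lemma splits3 o : splits (half_rows o) 3.
Proof. by case: o; vm_compute. Qed.

(** Three columns lead from a half to itself in 4 ways and to the other half in 2
    ways.  The case k = 0, where the remaining letters are too few for another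
    cut, has 2 words. *)
Lemma size_words o k : size (words (half_rows o) (3 * k + 4)) = 2 * 6 ^ k.
Proof.
elim: k o => [|k IHk] o; first by case: o; vm_compute.
have -> : 3 * k.+1 + 4 = 3 + (3 * k + 4) by lia.
have leb : 2 <= 3 * k + 4 by lia.
rewrite (perm_size (words_split _ _ _ (splits3 o) leb)).
rewrite size_cat !size_allpairs !IHk -mulnDl expnS mulnCA.
by congr (_ * _); case: o; vm_compute.
Qed.

(** Words of this length have no horizontal fault: their first four letters are
    those of P or of its flip, whose tiles cross the three horizontal lines. *)
Lemma perm_faultfree k :
  perm_eq (faultfree_tilings 4 (3 * (k + 3))) [seq decode 1 w | w <- words [::] (3 * k + 8)].
Proof.
have -> : 3 * (k + 3) = (3 * k + 8).+1 by lia.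
set n := 3 * k + 8.
apply: uniq_perm; first exact: fset_uniq.
  by rewrite map_inj_in_uniq ?uniq_paths //; exact: decode_words_inj.
move=> T; apply/idP/mapP => [|[w w_words ->]].
  rewrite in_fset inE /= => /andP[tilT ffT].
  have /decode_word_of def_T : T `<=` trominoes 4 n.+1.
    by move: tilT; rewrite /tilings in_fset inE /= fpowersetE => /andP[].
  exists (word_of n [pred c | tile_of c \in T]); last exact: def_T.
  have Ww := is_word_of n [pred c | tile_of c \in T].
  rewrite mem_words Ww size_map size_iota eqxx -(tilings_decode n) ?size_map ?size_iota //.
  rewrite -def_T tilT andbT /=; move: ffT; rewrite {1}def_T.
  by rewrite faultfree_decode ?size_map ?size_iota // => /andP[].
move: (w_words); rewrite mem_words => /and4P[/eqP size_w Ww nz_w ex_w].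
rewrite in_fset inE /= tilings_decode // ex_w faultfree_decode // nz_w andbT.
have leb : 2 <= 3 * k + 4 by lia.
have := perm_mem (words_split _ _ _ splits4 leb) w.
have -> : 4 + (3 * k + 4) = n by rewrite /n; lia.
rewrite w_words => /esym.
have span o x : x \in heads [::] 4 o ->
    all (fun i => has (has (fun p => p.1 == i)) x) (iota 1 3).
  by move: x; apply/allP; case: o; vm_compute.
rewrite mem_cat => /orP[] /allpairsPdep[x [y [/span/allP span_x _ ->]]];
  by apply/allP => i /span_x; rewrite has_cat => ->.
Qed.

Lemma size_words_start k : size (words [::] (3 * k + 8)) = 8 * 6 ^ k.
Proof.
have -> : 3 * k + 8 = 4 + (3 * k + 4) by lia.
have leb : 2 <= 3 * k + 4 by lia.
rewrite (perm_size (words_split _ _ _ splits4 leb)).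
rewrite size_cat !size_allpairs !size_words -mulnDl mulnA.
by congr (_ * _); vm_compute.
Qed.

(** * The pattern and the generators as codes *)

(** The square on rows i and i + 1 is sent to the one on rows 4 - i and 5 - i. *)
Definition flip_code (c : code) : code :=
  let: (j, (i, (dr, dc))) := c in (j, (4 - i, (~~ dr, dc))).

Lemma flip_tile_of (c : code) : c.2.1 <= 4 -> flip_tile (tile_of c) = tile_of (flip_code c).
Proof.
case: c => j [i [dr dc]] /= lei; apply/fsetP => x; rewrite /flip_tile mem_tile_of.
have -> : cells (j, (4 - i, (~~ dr, dc))) =i map flip_cell (cells (j, (i, (dr, dc)))).
  move=> y; rewrite /cells /= /flip_cell.
  have [eq1 eq2] : 5 - i.+1 = 4 - i /\ 5 - i = (4 - i).+1 by lia.
  by case: dr dc => [] []; rewrite /= !inE /= eq1 eq2; do 3!case: (y == _).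
by apply/imfsetP/mapP => -[y yP ->]; exists y; rewrite ?mem_tile_of // -mem_tile_of in yP *.
Qed.

Lemma flip_tiles_of (cs : seq code) :
  all (fun c => c.2.1 <= 4) cs -> flip (tiles_of cs) = tiles_of (map flip_code cs).
Proof.
move=> /allP le4; rewrite /flip; apply/fsetP => B.
apply/imfsetP/tiles_ofP => /= [[C]|[_ /mapP[c cP ->] ->]].
  case/tiles_ofP=> c cP -> ->; exists (flip_code c); first exact: map_f.
  by rewrite flip_tile_of ?le4.
by exists (tile_of c); rewrite ?mem_tiles_of ?flip_tile_of ?le4.
Qed.

Definition shift_code (k : nat) (c : code) : code := (c.1 + k, c.2).

Lemma shift_tile_of k (c : code) : shift_tile k (tile_of c) = tile_of (shift_code k c).
Proof.
apply/fsetP => x; rewrite /shift_tile mem_tile_of.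
have -> : cells (shift_code k c) = map (shift_cell k) (cells c).
  by rewrite /cells map_cat -!map_comp.
by apply/imfsetP/mapP => -[y yP ->]; exists y; rewrite // ?mem_tile_of // -mem_tile_of.
Qed.

Lemma shift_decode k j w : shift k (decode j w) = decode (j + k) w.
Proof.
rewrite /shift /decode.
have -> : codes (j + k) w = map (shift_code k) (codes j w).
  elim: w j => //= a w IHw j; rewrite -addSn IHw map_cat -map_comp.
  by congr (_ ++ _).
apply/fsetP => B; apply/imfsetP/tiles_ofP => /= [[C]|[_ /mapP[c cP ->] ->]].
  case/tiles_ofP=> c cP -> ->; exists (shift_code k c); first exact: map_f.
  exact: shift_tile_of.
by exists (tile_of c); rewrite ?mem_tiles_of ?shift_tile_of.
Qed.

Lemma decode_cat j u v : decode j (u ++ v) = decode j u `|` decode (j + size u) v.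
Proof. by rewrite /decode codes_cat tiles_of_cat. Qed.

Lemma tromino_tile_of x y z c : perm_eq [:: x; y; z] (cells c) -> tromino x y z = tile_of c.
Proof.
move=> /perm_mem eq_c; apply/fsetP => t; rewrite mem_tile_of -eq_c.
by rewrite !inE orbA.
Qed.

Definition hblock_codes (i j : nat) : seq (seq code) :=
  [:: [:: (j, (i, (true, true))); (j.+1, (i, (false, false)))];
      [:: (j, (i, (false, true))); (j.+1, (i, (true, false)))]].

Definition vblock_codes (i j : nat) : seq (seq code) :=
  [:: [:: (j, (i, (true, true))); (j, (i.+1, (false, false)))];
      [:: (j, (i, (true, false))); (j, (i.+1, (false, true)))]].

Lemma tiles_of2 B1 B2 c1 c2 :
  B1 = tile_of c1 -> B2 = tile_of c2 -> [fset B1; B2] = tiles_of [:: c1; c2].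
Proof.
move=> -> ->; apply/fsetP => B; rewrite !inE; apply/orP/tiles_ofP => [|[x]].
  by case=> /eqP ->; [exists c1 | exists c2]; rewrite // !inE eqxx ?orbT.
by rewrite !inE => /orP[] /eqP -> ->; [left | right].
Qed.

Lemma tiles_of4 B1 B2 B3 B4 c1 c2 c3 c4 :
    B1 = tile_of c1 -> B2 = tile_of c2 -> B3 = tile_of c3 -> B4 = tile_of c4 ->
  [fset B1; B2; B3; B4] = tiles_of [:: c1; c2; c3; c4].
Proof.
move=> def1 def2 def3 def4; apply/fsetP => B.
rewrite (tiles_of_cat [:: c1; c2] [:: c3; c4]).
by rewrite -(tiles_of2 _ _ _ _ def1 def2) -(tiles_of2 _ _ _ _ def3 def4) !inE !orbA.
Qed.

Lemma hblockE i j : hblock i j = map tiles_of (hblock_codes i j).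
Proof.
congr [:: _; _]; apply: tiles_of2; apply/fsetP => x;
  by rewrite mem_tile_of !inE; do 3!case: (x == _).
Qed.

Lemma vblockE i j : vblock i j = map tiles_of (vblock_codes i j).
Proof.
congr [:: _; _]; apply: tiles_of2; apply/fsetP => x;
  by rewrite mem_tile_of !inE; do 3!case: (x == _).
Qed.

Definition combine_codes (parts : seq (seq (seq code))) : seq (seq code) :=
  foldr (fun part acc => [seq p ++ q | p <- part, q <- acc]) [:: [::]] parts.

Lemma combineE (parts : seq (seq (seq code))) :
  combine (map (map tiles_of) parts) = map tiles_of (combine_codes parts).
Proof.
elim: parts => [|part parts IH] /=.
  by congr [:: _]; apply/fsetP => B; rewrite inE; apply/esym/tiles_ofP => -[].
rewrite -/(combine _) IH map_allpairs allpairs_mapl allpairs_mapr.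
by apply: eq_allpairs => p q; rewrite tiles_of_cat.
Qed.

Definition pattern_P_codes : seq (seq code) :=
  combine_codes [::
    [:: [:: (1, (1, (true, true))); (1, (3, (false, true)));
            (2, (2, (false, true))); (3, (3, (false, false)))]];
    hblock_codes 1 3].

Lemma pattern_PE : pattern_P = map tiles_of pattern_P_codes.
Proof.
rewrite /pattern_P hblockE -[RHS]combineE; congr (combine [:: [:: _]; _]).
by apply: tiles_of4; apply: tromino_tile_of.
Qed.

Lemma flip_pattern_PE : map flip pattern_P = map tiles_of (map (map flip_code) pattern_P_codes).
Proof.
rewrite pattern_PE -!map_comp; apply/eq_in_map => cs cs_P; apply: flip_tiles_of.
by move: cs cs_P; apply/allP; vm_compute.
Qed.

Definition generator_b_codes : seq (seq code) :=
  combine_codes [:: pattern_P_codes;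
    hblock_codes 3 5; hblock_codes 3 8; hblock_codes 1 6; hblock_codes 1 9].

Definition generator_c_codes : seq (seq code) :=
  combine_codes [:: map (map flip_code) pattern_P_codes;
    [:: [:: (5, (1, (true, true))); (7, (1, (true, false)))]];
    vblock_codes 2 6; hblock_codes 1 9; hblock_codes 3 8].

Definition generator_d_codes : seq (seq code) :=
  combine_codes [:: pattern_P_codes;
    [:: [:: (5, (3, (false, true))); (7, (3, (false, false)));
            (8, (1, (true, true))); (10, (1, (true, false)))]];
    vblock_codes 1 6; vblock_codes 2 9].

Definition generator_e_codes : seq (seq code) :=
  combine_codes [:: map (map flip_code) pattern_P_codes;
    hblock_codes 1 5; hblock_codes 3 6; vblock_codes 2 9;
    [:: [:: (8, (1, (true, true))); (10, (1, (true, false)))]]].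

Definition generator_codes : seq (seq code) :=
  generator_b_codes ++ generator_c_codes ++ generator_d_codes ++ generator_e_codes.

Lemma generatorsE : generators = map tiles_of generator_codes.
Proof.
have Eb : generator_b = map tiles_of generator_b_codes.
  by rewrite /generator_b pattern_PE !hblockE -[RHS]combineE.
have Ec : generator_c = map tiles_of generator_c_codes.
  rewrite /generator_c flip_pattern_PE !hblockE vblockE -[RHS]combineE.
  congr (combine [:: _; [:: _]; _; _; _]).
  by apply: tiles_of2; apply: tromino_tile_of.
have Ed : generator_d = map tiles_of generator_d_codes.
  rewrite /generator_d pattern_PE !vblockE -[RHS]combineE.
  congr (combine [:: _; [:: _]; _; _]).
  by apply: tiles_of4; apply: tromino_tile_of.
have Ee : generator_e = map tiles_of generator_e_codes.
  rewrite /generator_e flip_pattern_PE !hblockE vblockE -[RHS]combineE.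
  congr (combine [:: _; _; _; _; [:: _]]).
  by apply: tiles_of2; apply: tromino_tile_of.
by rewrite /generators Eb Ec Ed Ee -!map_cat.
Qed.

Definition orient_codes (o : bool) (css : seq (seq code)) : seq (seq code) :=
  if o then map (map flip_code) css else css.

Lemma orientedE o (css : seq (seq code)) :
  all (all (fun c => c.2.1 <= 4)) css ->
  oriented o (map tiles_of css) = map tiles_of (orient_codes o css).
Proof.
case: o => //= /allP le4; rewrite -!map_comp; apply/eq_in_map => cs /le4.
exact: flip_tiles_of.
Qed.

Definition word_of_codes (n : nat) (cs : seq code) : word := word_of n (mem cs).

Lemma decode_word_of_codes n (cs : seq code) :
  all (fun c => (c.1 \in iota 1 n) && (c.2 \in pieces)) cs ->
  decode 1 (word_of_codes n cs) = tiles_of cs.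
Proof.
move=> /allP cs_n; apply: eq_tiles_of => c; rewrite mem_codes_word_of andbA.
rewrite -[mem cs c]/(c \in cs); case c_cs: (c \in cs); rewrite ?andbF // andbT.
exact: cs_n.
Qed.

(** This reduces a statement on lists of tilings to a comparison of explicit
    lists of words, which is decided by computation. *)
Lemma perm_oriented n m o (css : seq (seq code)) :
    all (all (fun c => c.2.1 <= 4)) css ->
    all (all (fun c => (c.1 \in iota 1 n) && (c.2 \in pieces))) (orient_codes o css) ->
    perm_eq (map (word_of_codes n) (orient_codes o css)) (heads m n o) ->
  perm_eq (oriented o (map tiles_of css)) (map (decode 1) (heads m n o)).
Proof.
move=> le4 /allP css_n eq_css; rewrite orientedE //.
rewrite -(permPr (perm_map _ eq_css)) -map_comp.
suff -> : map tiles_of (orient_codes o css) =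
          map (decode 1 \o word_of_codes n) (orient_codes o css) by [].
by apply/eq_in_map => cs /css_n /decode_word_of_codes.
Qed.

Lemma perm_pattern_P o :
  perm_eq (oriented o pattern_P) (map (decode 1) (heads [::] 4 o)).
Proof. by rewrite pattern_PE; apply: perm_oriented; case: o; vm_compute. Qed.

(** The heart of the generation: the 72 fillings of each orientation exhaust the
    ways to reach the corresponding half after 10 columns. *)
Lemma perm_generators o :
  perm_eq (oriented o generators) (map (decode 1) (heads [::] 10 o)).
Proof. by rewrite generatorsE; apply: perm_oriented; case: o; vm_compute. Qed.

(** * Using the generators *)

(** P and its flip cover the first four columns, so all tiles beyond a copy of
    them have left column at least 5, and a tiling contains only one of the four
    copies: it is the one formed by its first four letters. *)
Lemma mem_remaining_parts o (p s : word) r :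
  p \in heads [::] 4 o ->
  (r \in remaining_parts (decode 1 (p ++ s))) = (r == (o, decode 5 s)).
Proof.
move=> p_o; have size_p := size_paths _ _ _ _ p_o.
have def_T : decode 1 (p ++ s) `\` decode 1 p = decode 5 s.
  rewrite decode_cat size_p; apply/fsetP => B; rewrite !inE.
  case: (boolP (B \in decode 5 s)) => [/tiles_ofP[c c_s ->]|_]; last by rewrite orbF andNb.
  rewrite orbT andbT mem_tiles_of; apply: contraTN c_s.
  rewrite !mem_codes => /andP[_ c_p]; rewrite negb_and -ltnNge ltnS; apply/orP; left.
  apply: contraTT c_p; rewrite -ltnNge => lt4c.
  by rewrite nth_default // size_p; move: lt4c; clear; lia.
have sub_p o' q : q \in heads [::] 4 o' -> decode 1 q `<=` decode 1 (p ++ s) ->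
    (o' == o) && (q == p).
  move=> q_o'; have size_q := size_paths _ _ _ _ q_o'.
  rewrite tiles_of_sub codes_cat size_p => /allP sub_q.
  have {sub_q} : all (mem (codes 1 p)) (codes 1 q).
    apply/allP => c c_q; move: (sub_q c c_q); rewrite /= mem_cat => /orP[// | c_s].
    move: c_q c_s; rewrite !mem_codes => /andP[_ c_q] /andP[lt4c _].
    by rewrite nth_default // size_q in c_q; move: lt4c; clear; lia.
  (* Only four words p and four words q are left to compare. *)
  apply/implyP; move: q q_o' {size_q}; apply/allP; move: p p_o {size_p def_T}; apply/allP.
  by case: o; case: o'; vm_compute.
apply/allpairsPdep/eqP => [[o' [P [_ + ->]]] | ->].
  rewrite mem_filter (perm_mem (perm_pattern_P o')) => /andP[subP /mapP[q q_o' def_P]].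
  rewrite def_P in subP *; have /andP[/eqP -> /eqP ->] := sub_p _ _ q_o' subP.
  by rewrite def_T.
exists o, (decode 1 p); rewrite def_T; split=> //; first by case: o p_o {sub_p}.
rewrite mem_filter (perm_mem (perm_pattern_P o)) map_f // andbT.
by rewrite decode_cat fsubsetUl.
Qed.

Lemma perm_allpairsC (S T : Type) (R : eqType) (f : S -> T -> R) s t :
  perm_eq [seq f x y | x <- s, y <- t] [seq f x y | y <- t, x <- s].
Proof.
elim: t => [|y t IHt] /=; first by elim: s.
by rewrite (perm_allpairs_consr f s (fun=> y) (fun=> t)) perm_cat2l.
Qed.

Lemma perm_glue (hs ws : seq word) (Fs : seq {fset {fset nat * nat}}) k j :
    {in hs, forall h, 1 + size h = j + k} -> perm_eq Fs (map (decode 1) hs) ->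
  perm_eq [seq F `|` shift k (decode j s) | s <- ws, F <- Fs]
          (map (decode 1) [seq h ++ s | h <- hs, s <- ws]).
Proof.
move=> size_hs eq_Fs; apply: perm_trans (perm_allpairsC _ _ _ _ _ _) _.
apply: perm_trans (perm_allpairs_dep _ eq_Fs (fun _ _ => perm_refl _)) _.
rewrite allpairs_mapl map_allpairs; set decoded := (X in perm_eq _ X).
suff <- : decoded = [seq decode 1 h `|` shift k (decode j s) | h <- hs, s <- ws] by [].
congr flatten; apply/eq_in_map => h h_hs; apply: eq_map => s.
by rewrite decode_cat shift_decode size_hs.
Qed.

(** Both lists are indexed by a filling of the first 10 columns and a word that
    completes its final half, because the shift by 6 places after column 10 the
    tiles found after column 4. *)
Lemma extend_words k (T : seq {fset {fset nat * nat}}) :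
  T =i map (decode 1) (words [::] (3 * k + 8)) ->
  perm_eq (extend T) (map (decode 1) (words [::] (3 * k + 14))).
Proof.
move=> eq_T.
have leb : 2 <= 3 * k + 4 by lia.
pose rests :=
  [seq (o, decode 5 s) | o <- [:: false; true], s <- words (half_rows o) (3 * k + 4)].
have eq_rests : perm_eq (undup (flatten (map remaining_parts T))) rests.
  apply: uniq_perm; rewrite ?undup_uniq //.
    apply: allpairs_uniq_dep => // [o _|]; first exact: uniq_paths.
    move=> _ _ /allpairsPdep[o [u [_ u_o ->]]] /allpairsPdep[o' [v [_ v_o' ->]]] /= [eq_o].
    rewrite -eq_o in v_o' * => eq_uv; congr existT.
    exact: decode_words_inj u_o v_o' eq_uv.
  move=> r; rewrite mem_undup.
  have eq_words := perm_mem (words_split _ _ _ splits4 leb).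
  have eq_n : 4 + (3 * k + 4) = 3 * k + 8 by lia.
  rewrite eq_n in eq_words.
  have [p4 p4P] : exists p4, forall o, p4 o \in heads [::] 4 o.
    exists (fun o => head [::] (heads [::] 4 o)) => o.
    by case: o; vm_compute.
  apply/flatten_mapP/allpairsPdep => [[t]|[o [s [_ s_o ->]]]].
    rewrite eq_T => /mapP[w w_words ->]; move: w_words.
    rewrite eq_words mem_cat => /orP[] /allpairsPdep[p [s [p_o s_o ->]]];
      rewrite (mem_remaining_parts _ _ _ _ p_o) => /eqP ->;
      by [exists false, s | exists true, s].
  exists (decode 1 (p4 o ++ s)); last by rewrite (mem_remaining_parts o).
  rewrite eq_T map_f // eq_words mem_cat.
  by case: o s_o => s_o; rewrite (allpairs_f _ _ s_o) ?orbT.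
rewrite /extend.
apply: perm_trans (perm_allpairs_dep _ eq_rests (fun r _ => perm_refl _)) _.
have -> : 3 * k + 14 = 10 + (3 * k + 4) by lia.
rewrite perm_sym (permPl (perm_map _ (words_split _ _ _ splits10 leb))).
have -> : rests = [seq (false, decode 5 s) | s <- words (half_rows false) (3 * k + 4)] ++
                  [seq (true, decode 5 s) | s <- words (half_rows true) (3 * k + 4)].
  by rewrite -[in RHS](cats0 [seq (true, _) | _ <- _]).
rewrite perm_sym [X in perm_eq X _]allpairs_cat map_cat.
have glue o := perm_glue _ (words (half_rows o) (3 * k + 4)) _ 6 5
  (fun h h_o => congr1 succn (size_paths _ _ _ _ h_o)) (perm_generators o).
by apply: perm_cat; rewrite [X in perm_eq X _]allpairs_mapl;
  [exact: (glue false) | exact: (glue true)].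
Qed.

Theorem theorem5 (t : nat) (ht : 3 <= t) :
  #|` faultfree_tilings 4 (3 * t)| = 8 * 6 ^ (t - 3) /\
  perm_eq (generated t) (faultfree_tilings 4 (3 * t)).
Proof.
rewrite -(subnK ht); move: (t - 3) => k {t ht}; rewrite addnK; split.
  by rewrite (perm_size (perm_faultfree k)) size_map size_words_start.
(* The recursion goes two steps back, so two consecutive cases are carried. *)
suff: perm_eq (generated (k + 3)) (faultfree_tilings 4 (3 * (k + 3))) /\
      perm_eq (generated (k + 4)) (faultfree_tilings 4 (3 * (k + 4))) by case.
elim: k => [|k [IHk IHk1]]; first by split; exact: perm_refl.
split; first by rewrite addSnnS.
have -> : generated (k.+1 + 4) = extend (generated (k + 3)).
  by rewrite addSn !addnS.
have eq_gen := perm_mem (perm_trans IHk (perm_faultfree k)).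
apply: perm_trans (extend_words k _ eq_gen) _; rewrite perm_sym.
have -> : k.+1 + 4 = k.+2 + 3 by lia.
have -> : 3 * k + 14 = 3 * k.+2 + 8 by lia.
exact: perm_faultfree.
Qed.
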